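(* Let $(M,d)$ be a complete metric space with $|M|\geq 3$. Let $F: M\to CB(M)$ be a multi-valued mapping satisfying the following conditions: (i) for all $u,v\in M$, if $v\in Fu$ and $u\neq v$, then $u\notin Fv$; (ii) $F\in \widetilde{\mathcal{F}}(M,d,\lambda)$ for some $\lambda\in (0,1)$. Then $\mathrm{Fix}(F)\neq \emptyset$.
   Context: For a metric space $(M,d)$, $CB(M)$ denotes the family of all nonempty bounded and closed subsets of $M$. For $A,B\in CB(M)$ and $a\in M$, let $D(a,B)=\inf\{d(a,b): b\in B\}$, let $\mathcal{D}(A,B)=\sup_{(a,b)\in A\times B}d(a,b)$, and let $H$ be the Hausdorff-Pompeiu metric $$H(A,B)=\max\left\{\sup_{a\in A} D(a,B),\ \sup_{b\in B}D(b,A)\right\}.$$ For a multi-valued mapping $F:M\to CB(M)$, $\mathrm{Fix}(F)=\{u\in M: u\in Fu\}$. For $|M|\geq 3$ and $\lambda\in(0,1)$, $\widetilde{\mathcal{F}}(M,d,\lambda)$ denotes the class of multi-valued mappings $F: M\to CB(M)$ satisfying $$H(Fx,Fy)+H(Fy,Fz)+ \mathcal{D}(Fz,Fx)\leq \lambda \left(d(x,y)+d(y,z)+d(z,x)\right)$$ for every three pairwise distinct points $x,y,z \in M$. *)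

(* Defs.v *)
From HB Require Import structures.
From mathcomp Require Import all_boot all_order all_algebra.
From mathcomp Require Import all_classical all_reals all_analysis.

Set Implicit Arguments.
Unset Strict Implicit.
Unset Printing Implicit Defensive.

Import Order.TTheory GRing.Theory Num.Theory.

Local Open Scope classical_set_scope.
Local Open Scope ring_scope.

#[short(type="completeMetricType")]
HB.structure Definition CompleteMetric (R : numDomainType) :=
  { M of Metric R M & Complete M }.

(* [inf] and [sup] of a set of reals are 0 when the extremum does not exist;
   for A and B in CB all the sets below are nonempty and bounded. *)
Section hausdorff_distance.
Context {R : realType} {M : metricType R}.
Implicit Types (A B : set M) (a : M) (F : M -> set M).

Definition CB : set (set M) :=
  [set A | [/\ A !=set0,
               exists r : R, forall x y, A x -> A y -> mdist x y <= r
             & closed A]].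

Definition point_dist a B : R := inf [set mdist a b | b in B].

Definition sup_dist A B : R := sup [set mdist p.1 p.2 | p in A `*` B].

Definition hausdorff_dist A B : R :=
  Num.max (sup [set point_dist a B | a in A]) (sup [set point_dist b A | b in B]).

Definition Fix F : set M := [set u | F u u].

Definition Ftilde (l : R) : set (M -> set M) :=
  [set F | (forall x, CB (F x)) /\
    forall x y z : M, x != y -> y != z -> z != x ->
      hausdorff_dist (F x) (F y) + hausdorff_dist (F y) (F z)
        + sup_dist (F z) (F x)
      <= l * (mdist x y + mdist y z + mdist z x)].

End hausdorff_distance.

(* Main.v *)
(** Suppose F has no fixed point. Each D(x, F x) is then positive, so there is a
    selection f x of F x with d(x, f x) <= q D(x, F x), where q > 1 is so close
    to 1 that k = q lambda < 1. By (i), x, f x and f (f x) are pairwise distinct,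
    and (ii) makes the perimeter of this triangle shrink by the factor k when x
    is replaced by f x. Hence the orbit of f is Cauchy; let x be its limit.
    Arbitrarily far along the orbit two consecutive terms differ from x, and (ii)
    applied to them and x forces D(x, F x) = 0, a contradiction. *)
Require Import Defs.
From mathcomp Require Import all_boot all_order all_algebra.
From mathcomp Require Import all_classical all_reals all_analysis.
From mathcomp Require Import lra.

Import Order.TTheory GRing.Theory Num.Theory.
Import numFieldNormedType.Exports.

Local Open Scope classical_set_scope.
Local Open Scope ring_scope.

Section distances.
Set Implicit Arguments.
Unset Strict Implicit.
Context {R : realType} {M : metricType R}.
Implicit Types (A B : set M) (a b c : M).

Lemma point_dist_le a B b : B b -> point_dist a B <= mdist a b.
Proof.
move=> Bb; apply: ge_inf; last by exists b.
by exists 0 => _ [y _ <-]; exact: mdist_ge0.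
Qed.

Lemma point_dist_ge0 a B : B !=set0 -> 0 <= point_dist a B.
Proof.
move=> [b Bb]; apply: lb_le_inf; first by exists (mdist a b), b.
by move=> _ [y _ <-]; exact: mdist_ge0.
Qed.

Lemma point_dist_lt a B r : B !=set0 -> point_dist a B < r ->
  exists2 b, B b & mdist a b < r.
Proof.
move=> [b Bb] /inf_lt -[|_ [y By <-] ?]; first by exists (mdist a b), b.
by exists y.
Qed.

(** At distance zero every ball around [a] would meet [B], putting [a] in the closure of [B]. *)
Lemma point_dist_gt0 a B : closed B -> B !=set0 -> ~ B a ->
  0 < point_dist a B.
Proof.
move=> clB B0 nBa; rewrite lt_neqAle point_dist_ge0// andbT eq_sym.
apply/negP => /eqP aB0; apply: nBa; apply: clB => V.
rewrite -nbhs_ballE => -[e /= e0 aeV].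
have [|b Bb abe] := @point_dist_lt a B e B0; first by rewrite aB0.
by exists b; split => //; apply: aeV; rewrite ballEmdist.
Qed.

Lemma point_dist_triangle a c B : B !=set0 ->
  point_dist a B <= mdist a c + point_dist c B.
Proof.
move=> B0; rewrite -lerBlDl; apply: lb_le_inf.
  by case: B0 => b Bb; exists (mdist c b), b.
move=> _ [b Bb <-]; rewrite lerBlDl.
by rewrite (le_trans (point_dist_le a Bb))// metric_triangle.
Qed.

(** Boundedness of [A] makes the first [sup] in [hausdorff_dist] a true upper bound rather than the
    default 0. *)
Lemma point_dist_le_hausdorff A B a : CB A -> CB B -> A a ->
  point_dist a B <= hausdorff_dist A B.
Proof.
move=> [_ [r Ar] _] [[b Bb] _ _] Aa; rewrite /hausdorff_dist le_max.
apply/orP; left; apply: ub_le_sup; last by exists a.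
exists (r + mdist a b) => _ [c Ac <-].
rewrite (le_trans (point_dist_le c Bb))//.
by rewrite (le_trans (metric_triangle c a b))// lerD2r Ar.
Qed.

Lemma hausdorff_dist_ge0 A B : CB A -> CB B -> 0 <= hausdorff_dist A B.
Proof.
move=> cA cB; have [[a Aa] _ _] := cA; have [B0 _ _] := cB.
exact: le_trans (point_dist_ge0 a B0) (point_dist_le_hausdorff cA cB Aa).
Qed.

Lemma mdist_le_sup_dist A B a b : CB A -> CB B -> A a -> B b ->
  mdist a b <= sup_dist A B.
Proof.
move=> [_ [r Ar] _] [_ [s Bs] _] Aa Bb.
apply: ub_le_sup; last by exists (a, b).
exists (r + (mdist a b + s)) => _ [[c d] [/= Ac Bd] <-].
rewrite (le_trans (metric_triangle c a d))// lerD ?Ar//.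
by rewrite (le_trans (metric_triangle a b d))// lerD2l Bs.
Qed.

End distances.

Lemma geometric_cvg {R : realType} {M : completeMetricType R} (u : nat -> M)
    (k C : R) : 0 <= k < 1 ->
    (forall n, mdist (u n) (u n.+1) <= C * k ^+ n) ->
  exists x : M, u @ \oo --> x.
Proof.
move=> /andP[k0 k1] uk; pose c := C / (1 - k).
have kN0 : 1 - k != 0 by rewrite gt_eqF// subr_gt0.
(* [c] is the sum of the series of [C * k ^+ n]; this identity closes the induction that peels off
   the first step of a path. *)
have cE : C + c * k = c.
  by apply: (mulIf kN0); rewrite /c mulrDl mulrAC divfK// -mulrDr subrK mulr1.
have C0 : 0 <= C by have := le_trans (mdist_ge0 _ _) (uk 0%N); rewrite mulr1.
have c0 : 0 <= c by rewrite divr_ge0// subr_ge0 ltW.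
have uc j n : mdist (u n) (u (n + j)%N) <= c * k ^+ n.
  elim: j n => [|j IH] n; first by rewrite addn0 mdistxx mulr_ge0// exprn_ge0.
  rewrite (le_trans (metric_triangle _ (u n.+1) _))// -cE mulrDl lerD//.
  by rewrite addnS -addSn (le_trans (IH n.+1))// exprS mulrA.
suff : cvg (u @ \oo) by move=> /cvg_ex.
apply: cauchy_cvg; apply: cauchy_exP => e e0.
have /cvgrPdist_lt/(_ e e0)[N _ /(_ N (leqnn _)) cN] :
    (fun n => c * k ^+ n) @ \oo --> (0 : R).
  by apply: cvg_geometric; rewrite ger0_norm.
exists (u N), N => // n /= Nn; rewrite ballEmdist /=.
rewrite -(subnKC Nn) (le_lt_trans (uc _ _))//.
by move: cN; rewrite sub0r normrN ger0_norm // mulr_ge0 // exprn_ge0.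
Qed.

Theorem theorem3p4 (R : realType) (M : completeMetricType R)
  (card_M : (`I_3 #<= [set: M])%card)
  (F : M -> set M) (F_CB : forall x, CB (F x))
  (F_i : forall u v, F u v -> u != v -> ~ F v u)
  (F_ii : exists2 l : R, 0 < l < 1 & Ftilde l F) :
  Fix F !=set0.
Proof.
have [l /andP[l0 l1] [_ Fl]] := F_ii.
pose x0 : M := point.
apply/set0P/eqP => Fix0.
have nofix x : ~ F x x by move=> Fxx; have : Fix F x by []; rewrite Fix0.
have FN0 x : F x !=set0 by case: (F_CB x).
have D0 x : 0 < point_dist x (F x).
  by case: (F_CB x) => ? _ clF; apply: point_dist_gt0.
(* Chosen so that [q * l] is the midpoint of [l] and 1. *)
pose q := (1 + l) / (2 * l).
have q0 : 0 < q by rewrite divr_gt0//; lra.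
have q1 : 1 < q by rewrite ltr_pdivlMr; lra.
pose k := (1 + l) / 2.
have ql : q * l = k by rewrite /q /k invfM mulrA mulfVK// gt_eqF.
have k01 : 0 <= k < 1 by rewrite /k; lra.
have /choice[f /all_and2[Ff fq]] x :
    exists y, F x y /\ mdist x y <= q * point_dist x (F x).
  have [|y Fxy /ltW xy] :=
      @point_dist_lt _ _ x _ (q * point_dist x (F x)) (FN0 x).
    by rewrite ltr_pMl.
  by exists y.
have fN x : x != f x by apply/eqP => xfx; apply: (nofix x); rewrite {2}xfx.
(* Since [f x] lies in [F x], condition (i) keeps [x] out of [F (f x)], which contains [f (f x)]. *)
have ffN x : f (f x) != x.
  by apply/eqP => ffx; apply: (F_i x (f x)) => //; rewrite -{2}ffx.
pose p x := mdist x (f x) + mdist (f x) (f (f x)) + mdist (f (f x)) x.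
have mf x : mdist (f x) (f (f x)) <= q * hausdorff_dist (F x) (F (f x)).
  by rewrite (le_trans (fq _))// ler_pM2l// point_dist_le_hausdorff.
have pk x : p (f x) <= k * p x.
  have := Fl x (f x) (f (f x)) (fN _) (fN _) (ffN _).
  rewrite -/(p x) -(ler_pM2l q0) mulrA ql; apply: le_trans.
  rewrite !mulrDr lerD// ?lerD//.
  (* The closing side joins arbitrary selected points, so only [sup_dist] controls it; no factor [q]
     is lost there, and [1 < q] absorbs the difference. *)
  rewrite (@le_trans _ _ (sup_dist (F (f (f x))) (F x)))//.
    exact: mdist_le_sup_dist.
  rewrite ler_peMl ?(ltW q1)// (le_trans (mdist_ge0 (f (f (f x))) (f x)))//.
  exact: mdist_le_sup_dist.
pose u n := iter n f x0.
have pu n : p (u n) <= p x0 * k ^+ n.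
  elim: n => [|n IH]; first by rewrite expr0 mulr1.
  rewrite (le_trans (pk _))// exprS mulrCA ler_wpM2l//.
  by case/andP: k01.
have [|x ux] := @geometric_cvg _ _ u k (p x0) k01.
  by move=> n; rewrite (le_trans _ (pu n))// /p -addrA lerDl addr_ge0 ?mdist_ge0.
(* With a and b the distances from [x] to [u n] and [u n.+1], the final estimate is D(x, F x) <= b +
   H(F (u n), F x) <= b + 2 (a + b), which is below 5 [e]. *)
pose e := point_dist x (F x) / 5.
have e0 : 0 < e by rewrite divr_gt0.
have [N _ uN] : \forall n \near \oo, ball x e (u n) by exact/ux/nbhsx_ballx.
(* If some late term equals x, the next two terms differ from it. *)
have [n Nn /andP[xn xSn]] : exists2 n, (N <= n)%N & (u n != x) && (x != u n.+1).
  have [/existsNP[n /not_implyP[Nn /negP]]|H] :=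
      EM (~ forall n, (N <= n)%N -> u n != x).
    rewrite negbK => /eqP <-; exists n.+1; first exact: leqW.
    by rewrite /u /= eq_sym fN eq_sym ffN.
  move/contrapT: H => H; exists N => //; rewrite H // eq_sym H // leqW.
have /= := uN n Nn; have /= := uN n.+1 (leqW Nn).
rewrite !ballEmdist /= => dSn dn.
(* With [x] in the middle, H(F (u n), F x) appears on the left; the other two terms are nonnegative
   and are dropped. *)
have := Fl (u n) x (u n.+1) xn xSn.
rewrite eq_sym => /(_ (fN _)) Flx.
have := point_dist_triangle x (u n.+1) (FN0 x).
have := point_dist_le_hausdorff (F_CB (u n)) (F_CB x) (Ff (u n)).
have := hausdorff_dist_ge0 (F_CB x) (F_CB (u n.+1)).
have := le_trans (mdist_ge0 _ _)
  (mdist_le_sup_dist (F_CB (u n.+1)) (F_CB (u n)) (Ff _) (Ff _)).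
have : l * (mdist (u n) x + mdist x (u n.+1) + mdist (u n.+1) (u n)) <=
    mdist (u n) x + mdist x (u n.+1) + mdist (u n.+1) (u n).
  by rewrite ler_piMl ?addr_ge0 ?mdist_ge0// ltW.
have := metric_triangle (u n.+1) x (u n).
move: Flx dSn dn; rewrite /e /u /= -/(u n) (metric_sym (u n) x).
rewrite (metric_sym (f _) x).
lra.
Qed.
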